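(* Let $\mathcal{B}$ be an abelian category with enough projective objects and enough injective objects, let $\mathsf{F}:\mathcal{B}\to\mathcal{B}$ be an additive right exact functor with $\mathsf{F}^2=0$, and let $\mathcal{B}\ltimes\mathsf{F}$ be the right trivial extension. Let $(\mathcal{X},\mathcal{Y})$ be a hereditary complete cotorsion pair in $\mathcal{B}$. If $\mathbb{L}_1\mathsf{F}(X)=0$ for all $X\in\mathcal{X}$ and $\mathsf{F}(\mathcal{X})\subseteq\mathcal{Y}$, then $(\mathsf{T}(\mathcal{X}),\mathsf{U}^{-1}(\mathcal{Y}))$ is a hereditary complete cotorsion pair in $\mathcal{B}\ltimes\mathsf{F}$.
   Context: The right trivial extension $\mathcal{B}\ltimes\mathsf{F}$ has as objects the pairs $(X,f)$ with $X\in\mathcal{B}$ and $f:\mathsf{F}(X)\to X$ such that $f\circ\mathsf{F}(f)=0$ (automatic when $\mathsf{F}^2=0$); a morphism $(X,f)\to(Y,g)$ is a morphism $\alpha:X\to Y$ in $\mathcal{B}$ with $\alpha\circ f=g\circ\mathsf{F}(\alpha)$. It is an abelian category with enough projectives, and exactness is computed in $\mathcal{B}$. $\mathbb{L}_1\mathsf{F}$ is the first left derived functor of $\mathsf{F}$. For $X\in\mathcal{B}$, $\mathsf{T}(X)=\left(X\oplus\mathsf{F}(X),\left(\begin{smallmatrix}0&0\\1&0\end{smallmatrix}\right)\right)$, the matrix being a morphism $\mathsf{F}(X)\oplus\mathsf{F}^2(X)\to X\oplus\mathsf{F}(X)$; $\mathsf{T}(\mathcal{X})$ is the class of objects isomorphic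 to $\mathsf{T}(X)$ with $X\in\mathcal{X}$. $\mathsf{U}^{-1}(\mathcal{Y})=\{(X,f) : X\in\mathcal{Y}\}$. In an abelian category $\mathcal{A}$, a pair $(\mathcal{C},\mathcal{D})$ of classes is a cotorsion pair if $\mathcal{C}=\{C:\mathrm{Ext}^1_{\mathcal{A}}(C,D)=0\ \forall D\in\mathcal{D}\}$ and $\mathcal{D}=\{D:\mathrm{Ext}^1_{\mathcal{A}}(C,D)=0\ \forall C\in\mathcal{C}\}$; it is complete if for every object $A$ there are exact sequences $0\to D\to C\to A\to0$ and $0\to A\to D'\to C'\to0$ with $C,C'\in\mathcal{C}$, $D,D'\in\mathcal{D}$; it is hereditary if $\mathrm{Ext}^i_{\mathcal{A}}(C,D)=0$ for all $i\ge1$, $C\in\mathcal{C}$, $D\in\mathcal{D}$. *)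

(* Defs.v *)
From HB Require Import structures.
From mathcomp Require Import all_boot all_algebra boolp.

Set Implicit Arguments.
Unset Strict Implicit.
Unset Printing Implicit Defensive.

Import GRing.Theory.
Local Open Scope ring_scope.

Reserved Notation "g \oc f" (at level 40, left associativity).

(* Morphisms are compared by Leibniz equality; the choice structure that comes
   with [zmodType] exists on every type by [boolp]. *)
Record preadditive := Preadditive {
  obj :> Type;
  Hom : obj -> obj -> zmodType;
  comp : forall A B C : obj, Hom B C -> Hom A B -> Hom A C;
  idm : forall A : obj, Hom A A;
  compA : forall A B C D (h : Hom C D) (g : Hom B C) (f : Hom A B),
    comp h (comp g f) = comp (comp h g) f;
  comp1m : forall A B (f : Hom A B), comp (idm B) f = f;
  compm1 : forall A B (f : Hom A B), comp f (idm A) = f;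
  compDl : forall A B C (g g' : Hom B C) (f : Hom A B),
    comp (g + g') f = comp g f + comp g' f;
  compDr : forall A B C (g : Hom B C) (f f' : Hom A B),
    comp g (f + f') = comp g f + comp g f'
}.

Arguments Hom {p} A B.
Arguments comp {p A B C} g f.
Arguments idm {p} A.

Notation "g \oc f" := (comp g f).

Section Preadditive.
Variable C : preadditive.
Implicit Types A B T : C.

Lemma comp0l A B T (f : Hom A B) : (0 : Hom B T) \oc f = 0.
Proof. by apply: (addrI ((0 : Hom B T) \oc f)); rewrite -compDl !addr0. Qed.

Lemma comp0r A B T (g : Hom B T) : g \oc (0 : Hom A B) = 0.
Proof. by apply: (addrI (g \oc (0 : Hom A B))); rewrite -compDr !addr0. Qed.

Lemma compNl A B T (g : Hom B T) (f : Hom A B) : (- g) \oc f = - (g \oc f).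
Proof. by apply: (addrI (g \oc f)); rewrite -compDl !subrr comp0l. Qed.

Lemma compNr A B T (g : Hom B T) (f : Hom A B) : g \oc (- f) = - (g \oc f).
Proof. by apply: (addrI (g \oc f)); rewrite -compDr !subrr comp0r. Qed.

Lemma compBl A B T (g g' : Hom B T) (f : Hom A B) :
  (g - g') \oc f = g \oc f - g' \oc f.
Proof. by rewrite compDl compNl. Qed.

Lemma compBr A B T (g : Hom B T) (f f' : Hom A B) :
  g \oc (f - f') = g \oc f - g \oc f'.
Proof. by rewrite compDr compNr. Qed.

Definition is_zero A : Prop :=
  (forall B (f : Hom A B), f = 0) /\ (forall B (f : Hom B A), f = 0).

Definition iso A B : Prop :=
  exists (f : Hom A B) (g : Hom B A), g \oc f = idm A /\ f \oc g = idm B.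

Definition mono A B (f : Hom A B) : Prop :=
  forall T (t t' : Hom T A), f \oc t = f \oc t' -> t = t'.

Definition epi A B (f : Hom A B) : Prop :=
  forall T (t t' : Hom B T), t \oc f = t' \oc f -> t = t'.

Definition is_kernel A B K (f : Hom A B) (k : Hom K A) : Prop :=
  f \oc k = 0 /\
  forall T (t : Hom T A), f \oc t = 0 -> exists! u : Hom T K, k \oc u = t.

Definition is_cokernel A B Q (f : Hom A B) (c : Hom B Q) : Prop :=
  c \oc f = 0 /\
  forall T (t : Hom B T), t \oc f = 0 -> exists! u : Hom Q T, u \oc c = t.

Record biproduct A B := Biproduct {
  bip :> C;
  in1 : Hom A bip;
  in2 : Hom B bip;
  pr1 : Hom bip A;
  pr2 : Hom bip B;
  pr1_in1 : pr1 \oc in1 = idm A;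
  pr2_in2 : pr2 \oc in2 = idm B;
  pr1_in2 : pr1 \oc in2 = 0;
  pr2_in1 : pr2 \oc in1 = 0;
  bip_id : in1 \oc pr1 + in2 \oc pr2 = idm bip
}.

Definition projective P : Prop :=
  forall A B (e : Hom A B) (f : Hom P B),
    epi e -> exists g : Hom P A, e \oc g = f.

Definition injective_obj I : Prop :=
  forall A B (m : Hom A B) (f : Hom A I),
    mono m -> exists g : Hom B I, g \oc m = f.

Definition enough_projectives : Prop :=
  forall A, exists (P : C) (e : Hom P A), projective P /\ epi e.

Definition enough_injectives : Prop :=
  forall A, exists (I : C) (m : Hom A I), injective_obj I /\ mono m.

Lemma mono_inj0 A B (f : Hom A B) :
  (forall T (t : Hom T A), f \oc t = 0 -> t = 0) -> mono f.
Proof.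
move=> h T t t' /eqP; rewrite -subr_eq0 -compBr => /eqP/h/eqP.
by rewrite subr_eq0 => /eqP.
Qed.

Lemma epi_inj0 A B (f : Hom A B) :
  (forall T (t : Hom B T), t \oc f = 0 -> t = 0) -> epi f.
Proof.
move=> h T t t' /eqP; rewrite -subr_eq0 -compBl => /eqP/h/eqP.
by rewrite subr_eq0 => /eqP.
Qed.

Lemma kernel_mono A B K (f : Hom A B) (k : Hom K A) : is_kernel f k -> mono k.
Proof.
move=> [k0 kU] T t t' e.
have [|u [_ uU]] := kU T (k \oc t); first by rewrite compA k0 comp0l.
by rewrite -(uU t erefl) -(uU t').
Qed.

Lemma cokernel_epi A B Q (f : Hom A B) (c : Hom B Q) :
  is_cokernel f c -> epi c.
Proof.
move=> [c0 cU] T t t' e.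
have [|u [_ uU]] := cU T (t \oc c); first by rewrite -compA c0 comp0r.
by rewrite -(uU t erefl) -(uU t').
Qed.

Lemma is_kernelI A B K (f : Hom A B) (k : Hom K A) :
  f \oc k = 0 -> mono k ->
  (forall T (t : Hom T A), f \oc t = 0 -> exists u : Hom T K, k \oc u = t) ->
  is_kernel f k.
Proof.
move=> k0 km kU; split=> // T t /kU[u ut]; exists u; split=> // v vt.
by apply: km; rewrite ut.
Qed.

Lemma is_cokernelI A B Q (f : Hom A B) (c : Hom B Q) :
  c \oc f = 0 -> epi c ->
  (forall T (t : Hom B T), t \oc f = 0 -> exists u : Hom Q T, u \oc c = t) ->
  is_cokernel f c.
Proof.
move=> c0 ce cU; split=> // T t /cU[u ut]; exists u; split=> // v vt.
by apply: ce; rewrite ut.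
Qed.

End Preadditive.

Arguments in1 {C A B} b.
Arguments in2 {C A B} b.
Arguments pr1 {C A B} b.
Arguments pr2 {C A B} b.
Arguments enough_projectives C : clear implicits.
Arguments enough_injectives C : clear implicits.

Record abelian := Abelian {
  abelian_cat :> preadditive;
  zero_obj : abelian_cat;
  zero_objP : is_zero zero_obj;
  biprod : forall A B : abelian_cat, biproduct A B;
  ker : forall (A B : abelian_cat), Hom A B -> abelian_cat;
  ker_inc : forall (A B : abelian_cat) (f : Hom A B), Hom (ker f) A;
  ker_incP : forall (A B : abelian_cat) (f : Hom A B),
    is_kernel f (ker_inc f);
  coker : forall (A B : abelian_cat), Hom A B -> abelian_cat;
  coker_proj : forall (A B : abelian_cat) (f : Hom A B), Hom B (coker f);
  coker_projP : forall (A B : abelian_cat) (f : Hom A B),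
    is_cokernel f (coker_proj f);
  mono_normal : forall (A B : abelian_cat) (f : Hom A B), mono f ->
    exists (D : abelian_cat) (g : Hom B D), is_kernel g f;
  epi_normal : forall (A B : abelian_cat) (f : Hom A B), epi f ->
    exists (D : abelian_cat) (g : Hom D A), is_cokernel g f
}.

Arguments zero_obj a : clear implicits.
Arguments biprod {a} A B.
Arguments ker {a A B} f.
Arguments ker_inc {a A B} f.
Arguments coker {a A B} f.
Arguments coker_proj {a A B} f.

Section Abelian.
Variable Ab : abelian.
Implicit Types A B T : Ab.

Definition im A B (f : Hom A B) : Ab := ker (coker_proj f).
Definition im_inc A B (f : Hom A B) : Hom (im f) B := ker_inc (coker_proj f).

(* The image of [f] is the kernel of [g], as subobjects of [B]. *)
Definition exact A B T (f : Hom A B) (g : Hom B T) : Prop :=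
  is_kernel g (im_inc f).

Definition short_exact A B T (f : Hom A B) (g : Hom B T) : Prop :=
  [/\ mono f, exact f g & epi g].

Lemma ker_lift_ex A B T (g : Hom A B) (f : Hom T A) :
  g \oc f = 0 -> exists u : Hom T (ker g), ker_inc g \oc u = f.
Proof. by move=> /(ker_incP g).2[u [uf _]]; exists u. Qed.

Definition ker_lift A B T (g : Hom A B) (f : Hom T A) (gf0 : g \oc f = 0) :
  Hom T (ker g) := projT1 (cid (ker_lift_ex gf0)).

Lemma ker_liftE A B T (g : Hom A B) (f : Hom T A) (gf0 : g \oc f = 0) :
  ker_inc g \oc ker_lift gf0 = f.
Proof. exact: projT2 (cid (ker_lift_ex gf0)). Qed.

Definition homology A B T (f : Hom A B) (g : Hom B T) (gf0 : g \oc f = 0) : Ab :=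
  coker (ker_lift gf0).

Lemma mono_ker_coker A B (f : Hom A B) : mono f -> is_kernel (coker_proj f) f.
Proof.
move=> fm; have [D [g [gf gU]]] := mono_normal fm.
have [cf cU] := coker_projP f.
apply: is_kernelI => // T t ct; have [v [vc _]] := cU _ g gf.
have [|u [ut _]] := gU T t; first by rewrite -vc -compA ct comp0r.
by exists u.
Qed.

Lemma epi_coker_ker A B (f : Hom A B) : epi f -> is_cokernel (ker_inc f) f.
Proof.
move=> fe; have [D [g [fg gU]]] := epi_normal fe.
have [fk kU] := ker_incP f.
apply: is_cokernelI => // T t tk; have [v [vc _]] := kU _ g fg.
have [|u [ut _]] := gU T t; first by rewrite -vc compA tk comp0l.
by exists u.
Qed.

Lemma exact_comp0 A B T (f : Hom A B) (g : Hom B T) : exact f g -> g \oc f = 0.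
Proof.
move=> [gi _]; have [cf _] := coker_projP f.
by have [u <-] := ker_lift_ex cf; rewrite compA gi comp0l.
Qed.

Lemma exact_epi_cokernel A B T (f : Hom A B) (g : Hom B T) :
  exact f g -> epi g -> is_cokernel f g.
Proof.
move=> ex ge; apply: is_cokernelI => //; first exact: exact_comp0.
move=> D t tf; have [cf cU] := coker_projP f.
have [t' [t'c _]] := cU _ t tf.
have [gk gU] := epi_coker_ker ge.
have [y [yk _]] := ex.2 _ (ker_inc g) gk.
have [|u [ut _]] := gU D t; last by exists u.
rewrite -yk -t'c -compA (compA (coker_proj f)) (ker_incP (coker_proj f)).1.
by rewrite comp0l comp0r.
Qed.

End Abelian.

Section Resolution.
Variables (Ab : abelian) (hP : enough_projectives Ab).
Implicit Types A D : Ab.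

Definition proj_cover A : Ab := projT1 (cid (hP A)).
Definition proj_epi A : Hom (proj_cover A) A :=
  projT1 (cid (projT2 (cid (hP A)))).

Lemma proj_coverP A : projective (proj_cover A).
Proof. exact: (projT2 (cid (projT2 (cid (hP A))))).1. Qed.

Lemma proj_epiP A : epi (proj_epi A).
Proof. exact: (projT2 (cid (projT2 (cid (hP A))))).2. Qed.

Fixpoint syzygy A (n : nat) : Ab :=
  if n is m.+1 then ker (proj_epi (syzygy A m)) else A.

(* The chosen projective resolution ... -> P_1 -> P_0 (-> A), continued by
   P_{-1} = 0: [res A n] is P_n, [res_tgt A n] is P_{n-1}. *)
Definition res A (n : nat) : Ab := proj_cover (syzygy A n).

Definition res_tgt A (n : nat) : Ab :=
  if n is m.+1 then res A m else zero_obj Ab.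

Definition res_d A (n : nat) : Hom (res A n) (res_tgt A n) :=
  match n with
  | 0 => 0
  | m.+1 => ker_inc (proj_epi (syzygy A m)) \oc proj_epi (syzygy A m.+1)
  end.

Lemma res_dd A n : res_d A n \oc res_d A n.+1 = 0.
Proof.
case: n => [|n] /=; first by rewrite comp0l.
rewrite -[X in X \oc _]/(ker_inc _ \oc _) -compA (compA (proj_epi _)).
by rewrite (ker_incP (proj_epi _)).1 comp0l comp0r.
Qed.

Definition cocycle (n : nat) A D : {pred Hom (res A n) D} :=
  fun f => f \oc res_d A n.+1 == 0.

Lemma cocycleE n A D (f : Hom (res A n) D) :
  (f \in @cocycle n A D) = (f \oc res_d A n.+1 == 0).
Proof. by []. Qed.

Lemma cocycle_zmod_closed n A D : zmod_closed (@cocycle n A D).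
Proof.
split=> [|f g]; first by rewrite cocycleE comp0l.
by rewrite !cocycleE => /eqP f0 /eqP g0; rewrite compBl f0 g0 subr0.
Qed.
HB.instance Definition _ n A D :=
  GRing.isZmodClosed.Build _ (@cocycle n A D) (@cocycle_zmod_closed n A D).

Definition cocycles (n : nat) A D := {f : Hom (res A n) D | f \in @cocycle n A D}.
HB.instance Definition _ n A D := SubChoice.on (cocycles n A D).
HB.instance Definition _ n A D :=
  [SubChoice_isSubZmodule of cocycles n A D by <:].

Definition coboundary (n : nat) A D : {pred cocycles n A D} :=
  fun z => `[< exists g : Hom (res_tgt A n) D, val z = g \oc res_d A n >].

Lemma coboundaryP n A D (z : cocycles n A D) :
  reflect (exists g : Hom (res_tgt A n) D, val z = g \oc res_d A n)
    (z \in @coboundary n A D).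
Proof. exact: asboolP. Qed.

Lemma coboundary_zmod_closed n A D : zmod_closed (@coboundary n A D).
Proof.
split=> [|x y]; first by apply/coboundaryP; exists 0; rewrite comp0l.
move=> /coboundaryP[g xg] /coboundaryP[h yh]; apply/coboundaryP.
by exists (g - h); rewrite compBl -xg -yh.
Qed.
HB.instance Definition _ n A D :=
  GRing.isZmodClosed.Build _ (@coboundary n A D) (@coboundary_zmod_closed n A D).

(* Ext^n(A, D) = H^n(Hom(P, D)), for the chosen resolution P of A. *)
Definition Ext (n : nat) A D : zmodType := Quotient.quot (@coboundary n A D).

Definition Ext_vanish (n : nat) A D : Prop := forall x : Ext n A D, x = 0.

Lemma Ext_vanishP n A D :
  Ext_vanish n A D <->
  forall f : Hom (res A n) D, f \oc res_d A n.+1 = 0 ->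
    exists g : Hom (res_tgt A n) D, f = g \oc res_d A n.
Proof.
split=> [E0 f f0 | H x].
  have fZ : f \in @cocycle n A D by rewrite cocycleE f0.
  pose z : cocycles n A D := exist _ f fZ.
  have : z \in @coboundary n A D.
    rewrite -[z]subr0 Quotient.idealrBE.
    by apply/eqP; rewrite [LHS]E0 [RHS]E0.
  by move=> /coboundaryP.
rewrite -[x]reprK; set z := repr x.
have zB : z \in @coboundary n A D.
  by apply/coboundaryP/H/eqP; rewrite -cocycleE; apply: valP.
move: zB; rewrite -[z in z \in _]subr0 Quotient.idealrBE => /eqP ->.
exact: raddf0.
Qed.

End Resolution.

Record additive_functor (C D : preadditive) := AdditiveFunctor {
  fobj :> C -> D;
  fmap : forall A B : C, Hom A B -> Hom (fobj A) (fobj B);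
  fmap1 : forall A : C, fmap (idm A) = idm (fobj A);
  fmapC : forall (A B T : C) (g : Hom B T) (f : Hom A B),
    fmap (g \oc f) = fmap g \oc fmap f;
  fmapD : forall (A B : C) (f g : Hom A B), fmap (f + g) = fmap f + fmap g
}.

Arguments fmap {C D} a {A B} f.

Definition right_exact (A B : abelian) (F : additive_functor A B) : Prop :=
  forall (X Y Z : A) (f : Hom X Y) (g : Hom Y Z),
    exact f g -> epi g -> exact (fmap F f) (fmap F g) /\ epi (fmap F g).

Section Functor.
Variables (C D : preadditive) (F : additive_functor C D).

Lemma fmap0 (A B : C) : fmap F (0 : Hom A B) = 0.
Proof. by apply: (addrI (fmap F (0 : Hom A B))); rewrite -fmapD !addr0. Qed.

End Functor.

Section RightExact.
Variables (A B : abelian) (F : additive_functor A B) (hF : right_exact F).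

Lemma right_exact_coker (X Y : A) (f : Hom X Y) :
  is_cokernel (fmap F f) (fmap F (coker_proj f)).
Proof.
have [||ex fe] := @hF _ _ _ f (coker_proj f).
- exact: ker_incP.
- exact: cokernel_epi (coker_projP f).
exact: exact_epi_cokernel.
Qed.

Lemma right_exact_epi (X Y : A) (f : Hom X Y) : epi f -> epi (fmap F f).
Proof.
move=> fe; apply: epi_inj0 => T t tf.
have c0 : coker_proj f = 0.
  by apply: fe; rewrite (coker_projP f).1 comp0l.
have [_ cU] := right_exact_coker f.
by have [u [<- _]] := cU T t tf; rewrite c0 fmap0 comp0r.
Qed.

End RightExact.

Lemma fmap_res_dd (A B : abelian) (hP : enough_projectives A)
    (F : additive_functor A B) (n : nat) (X : A) :
  fmap F (res_d hP X n) \oc fmap F (res_d hP X n.+1) = 0.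
Proof. by rewrite -fmapC res_dd fmap0. Qed.

(* L_n F (X) = H_n(F P), for the chosen resolution P of X. *)
Definition left_derived (A B : abelian) (hP : enough_projectives A)
    (F : additive_functor A B) (n : nat) (X : A) : B :=
  homology (fmap_res_dd hP F n X).

Section Cotorsion.
Variables (Ab : abelian) (hP : enough_projectives Ab).
Variables (C D : Ab -> Prop).

Definition cotorsion_pair : Prop :=
  (forall A, C A <-> forall B, D B -> Ext_vanish hP 1 A B) /\
  (forall B, D B <-> forall A, C A -> Ext_vanish hP 1 A B).

Definition cotorsion_complete : Prop :=
  forall A : Ab,
    (exists (D0 C0 : Ab) (f : Hom D0 C0) (g : Hom C0 A),
       [/\ D D0, C C0 & short_exact f g]) /\
    (exists (D1 C1 : Ab) (f : Hom A D1) (g : Hom D1 C1),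
       [/\ D D1, C C1 & short_exact f g]).

Definition cotorsion_hereditary : Prop :=
  forall (i : nat) (A B : Ab), (1 <= i)%N -> C A -> D B -> Ext_vanish hP i A B.

Definition hereditary_complete_cotorsion_pair : Prop :=
  [/\ cotorsion_pair, cotorsion_complete & cotorsion_hereditary].

End Cotorsion.

Section TrivialExtension.
Variables (B : abelian) (F : additive_functor B B).

Record te_obj := TeObj {
  te_car : B;
  te_map : Hom (F te_car) te_car;
  te_mapK : te_map \oc fmap F te_map = 0
}.

Definition te_mor (X Y : te_obj) : {pred Hom (te_car X) (te_car Y)} :=
  fun a => a \oc te_map X == te_map Y \oc fmap F a.

Lemma te_morE X Y (a : Hom (te_car X) (te_car Y)) :
  (a \in @te_mor X Y) = (a \oc te_map X == te_map Y \oc fmap F a).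
Proof. by []. Qed.

Lemma te_mor_zmod_closed X Y : zmod_closed (@te_mor X Y).
Proof.
have fmapN (P Q : B) (a : Hom P Q) : fmap F (- a) = - fmap F a.
  by apply: (addrI (fmap F a)); rewrite -fmapD !subrr fmap0.
split=> [|a b]; rewrite !te_morE; first by rewrite fmap0 comp0l comp0r.
move=> /eqP ea /eqP eb; rewrite compBl ea eb fmapD fmapN.
by rewrite compDr compNr.
Qed.
HB.instance Definition _ X Y :=
  GRing.isZmodClosed.Build _ (@te_mor X Y) (@te_mor_zmod_closed X Y).

Definition te_hom (X Y : te_obj) :=
  {a : Hom (te_car X) (te_car Y) | a \in @te_mor X Y}.
HB.instance Definition _ X Y := SubChoice.on (te_hom X Y).
HB.instance Definition _ X Y := [SubChoice_isSubZmodule of te_hom X Y by <:].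

Lemma te_homP X Y (a : te_hom X Y) :
  val a \oc te_map X = te_map Y \oc fmap F (val a).
Proof. by have := valP a; rewrite te_morE => /eqP. Qed.

Lemma te_hom_ex X Y (a : Hom (te_car X) (te_car Y)) :
  a \oc te_map X = te_map Y \oc fmap F a -> a \in @te_mor X Y.
Proof. by move=> e; rewrite te_morE e. Qed.

Definition TeHom X Y (a : Hom (te_car X) (te_car Y))
    (e : a \oc te_map X = te_map Y \oc fmap F a) : te_hom X Y :=
  exist _ a (te_hom_ex e).

Lemma te_comp_subproof X Y Z (b : te_hom Y Z) (a : te_hom X Y) :
  (val b \oc val a) \oc te_map X = te_map Z \oc fmap F (val b \oc val a).
Proof. by rewrite fmapC compA -te_homP -!compA te_homP. Qed.

Lemma te_id_subproof X :
  idm (te_car X) \oc te_map X = te_map X \oc fmap F (idm (te_car X)).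
Proof. by rewrite comp1m fmap1 compm1. Qed.

Definition te_preadditive : preadditive.
Proof.
refine (@Preadditive te_obj (fun X Y => te_hom X Y : zmodType)
  (fun X Y Z b a => TeHom (te_comp_subproof b a))
  (fun X => TeHom (te_id_subproof X)) _ _ _ _ _).
- by move=> X Y Z T h g f; apply: val_inj; rewrite /= compA.
- by move=> X Y f; apply: val_inj; rewrite /= comp1m.
- by move=> X Y f; apply: val_inj; rewrite /= compm1.
- by move=> X Y Z g g' f; apply: val_inj; rewrite /= compDl.
- by move=> X Y Z g f f'; apply: val_inj; rewrite /= compDr.
Defined.

Local Notation E := te_preadditive.

Lemma te_kernelP (X Y K : E) (a : Hom X Y) (k : Hom K X) :
  is_kernel (val a) (val k) -> is_kernel a k.
Proof.
move=> kP; have km := kernel_mono kP; have [ak kU] := kP.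
apply: is_kernelI.
- exact: val_inj.
- by move=> T t t' /(congr1 val)/km/val_inj.
move=> T t /(congr1 val)/kU[u [ut _]].
suff e : u \oc te_map T = te_map K \oc fmap F u.
  by exists (TeHom e); apply: val_inj.
apply: km; rewrite compA ut te_homP -ut fmapC compA.
by rewrite -(te_homP k) compA.
Qed.

Variable hF : right_exact F.

Lemma te_cokernelP (X Y Q : E) (a : Hom X Y) (c : Hom Y Q) :
  is_cokernel (val a) (val c) -> is_cokernel a c.
Proof.
move=> cP; have ce := cokernel_epi cP; have [ca cU] := cP.
apply: is_cokernelI.
- exact: val_inj.
- by move=> T t t' /(congr1 val)/ce/val_inj.
move=> T t /(congr1 val)/cU[u [ut _]].
suff e : u \oc te_map Q = te_map T \oc fmap F u.
  by exists (TeHom e); apply: val_inj.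
apply: (right_exact_epi hF ce).
by rewrite -compA -te_homP compA ut te_homP -ut fmapC compA.
Qed.

Lemma te_ker_map_ex (X Y : E) (a : Hom X Y) :
  exists h : Hom (F (ker (val a))) (ker (val a)),
    ker_inc (val a) \oc h = te_map X \oc fmap F (ker_inc (val a)).
Proof.
apply: ker_lift_ex.
by rewrite compA te_homP -compA -fmapC (ker_incP (val a)).1 fmap0 comp0r.
Qed.

Definition te_ker_map (X Y : E) (a : Hom X Y) :=
  projT1 (cid (te_ker_map_ex a)).

Lemma te_ker_mapE (X Y : E) (a : Hom X Y) :
  ker_inc (val a) \oc te_ker_map a = te_map X \oc fmap F (ker_inc (val a)).
Proof. exact: projT2 (cid (te_ker_map_ex a)). Qed.

Lemma te_ker_mapK (X Y : E) (a : Hom X Y) :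
  te_ker_map a \oc fmap F (te_ker_map a) = 0.
Proof.
apply: (kernel_mono (ker_incP (val a))).
rewrite comp0r compA te_ker_mapE -compA -fmapC te_ker_mapE.
by rewrite fmapC compA te_mapK comp0l.
Qed.

Definition te_ker (X Y : E) (a : Hom X Y) : E := TeObj (te_ker_mapK a).

Definition te_ker_inc (X Y : E) (a : Hom X Y) : Hom (te_ker a) X :=
  @TeHom (te_ker a) X (ker_inc (val a)) (te_ker_mapE a).

Lemma te_ker_incP (X Y : E) (a : Hom X Y) : is_kernel a (te_ker_inc a).
Proof. exact/te_kernelP/ker_incP. Qed.

Lemma te_coker_map_ex (X Y : E) (a : Hom X Y) :
  exists h : Hom (F (coker (val a))) (coker (val a)),
    h \oc fmap F (coker_proj (val a)) = coker_proj (val a) \oc te_map Y.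
Proof.
have [_ cU] := right_exact_coker hF (val a).
have [|h [hE _]] := cU _ (coker_proj (val a) \oc te_map Y); last by exists h.
by rewrite -compA -te_homP compA (coker_projP (val a)).1 comp0l.
Qed.

Definition te_coker_map (X Y : E) (a : Hom X Y) :=
  projT1 (cid (te_coker_map_ex a)).

Lemma te_coker_mapE (X Y : E) (a : Hom X Y) :
  te_coker_map a \oc fmap F (coker_proj (val a)) =
  coker_proj (val a) \oc te_map Y.
Proof. exact: projT2 (cid (te_coker_map_ex a)). Qed.

Lemma te_coker_mapK (X Y : E) (a : Hom X Y) :
  te_coker_map a \oc fmap F (te_coker_map a) = 0.
Proof.
have ce := right_exact_epi hF (cokernel_epi (coker_projP (val a))).
apply: (right_exact_epi hF ce).
rewrite comp0l -compA -fmapC te_coker_mapE fmapC compA te_coker_mapE.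
by rewrite -compA te_mapK comp0r.
Qed.

Definition te_coker (X Y : E) (a : Hom X Y) : E := TeObj (te_coker_mapK a).

Definition te_coker_proj (X Y : E) (a : Hom X Y) : Hom Y (te_coker a) :=
  @TeHom Y (te_coker a) (coker_proj (val a)) (esym (te_coker_mapE a)).

Lemma te_coker_projP (X Y : E) (a : Hom X Y) : is_cokernel a (te_coker_proj a).
Proof. exact/te_cokernelP/coker_projP. Qed.

Lemma te_monoP (X Y : E) (a : Hom X Y) : mono a <-> mono (val a).
Proof.
split=> am; last by move=> T t t' /(congr1 val)/am/val_inj.
have /(congr1 val)/= k0 : te_ker_inc a = 0.
  by apply: am; rewrite (te_ker_incP a).1 comp0r.
by apply: mono_inj0 => T t /ker_lift_ex[u <-]; rewrite k0 comp0l.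
Qed.

Lemma te_epiP (X Y : E) (a : Hom X Y) : epi a <-> epi (val a).
Proof.
split=> ae; last by move=> T t t' /(congr1 val)/ae/val_inj.
have /(congr1 val)/= c0 : te_coker_proj a = 0.
  by apply: ae; rewrite (te_coker_projP a).1 comp0l.
apply: epi_inj0 => T t /(coker_projP (val a)).2[u [<- _]].
by rewrite c0 comp0r.
Qed.

Lemma te_zero_mapK :
  (0 : Hom (F (zero_obj B)) (zero_obj B)) \oc
  fmap F (0 : Hom (F (zero_obj B)) (zero_obj B)) = 0.
Proof. exact: comp0l. Qed.

Definition te_zero : E := TeObj te_zero_mapK.

Lemma te_zeroP : is_zero te_zero.
Proof.
by split=> X f; apply: val_inj; [apply: (zero_objP B).1|apply: (zero_objP B).2].
Qed.

Section Biproduct.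
Variables X Y : E.
Let S := biprod (te_car X) (te_car Y).

Definition te_bip_map : Hom (F S) S :=
  in1 S \oc te_map X \oc fmap F (pr1 S) + in2 S \oc te_map Y \oc fmap F (pr2 S).

Lemma te_bip_in1 :
  in1 S \oc te_map X = te_bip_map \oc fmap F (in1 S).
Proof.
rewrite compDl -!compA -!fmapC pr1_in1 pr2_in1 fmap0 fmap1 compm1.
by rewrite !comp0r addr0.
Qed.

Lemma te_bip_in2 :
  in2 S \oc te_map Y = te_bip_map \oc fmap F (in2 S).
Proof.
rewrite compDl -!compA -!fmapC pr1_in2 pr2_in2 fmap0 fmap1 compm1.
by rewrite !comp0r add0r.
Qed.

Lemma te_bip_pr1 :
  pr1 S \oc te_bip_map = te_map X \oc fmap F (pr1 S).
Proof. by rewrite compDr !compA pr1_in1 pr1_in2 comp1m !comp0l addr0. Qed.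

Lemma te_bip_pr2 :
  pr2 S \oc te_bip_map = te_map Y \oc fmap F (pr2 S).
Proof. by rewrite compDr !compA pr2_in1 pr2_in2 comp1m !comp0l add0r. Qed.

Lemma te_bip_mapK : te_bip_map \oc fmap F te_bip_map = 0.
Proof.
rewrite {1}/te_bip_map compDl -!compA -!fmapC te_bip_pr1 te_bip_pr2 !fmapC.
by rewrite !(compA (te_map _)) !te_mapK !comp0l !comp0r addr0.
Qed.

Definition te_bip : E := TeObj te_bip_mapK.

Definition te_biproduct : biproduct X Y.
Proof.
refine (@Biproduct E X Y te_bip
  (@TeHom X te_bip (in1 S) te_bip_in1) (@TeHom Y te_bip (in2 S) te_bip_in2)
  (@TeHom te_bip X (pr1 S) te_bip_pr1) (@TeHom te_bip Y (pr2 S) te_bip_pr2)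
  _ _ _ _ _); apply: val_inj => /=.
- exact: pr1_in1.
- exact: pr2_in2.
- exact: pr1_in2.
- exact: pr2_in1.
- exact: bip_id.
Defined.

End Biproduct.

Lemma te_mono_normal (X Y : E) (a : Hom X Y) :
  mono a -> exists (Z : E) (b : Hom Y Z), is_kernel b a.
Proof.
move=> /te_monoP am; exists (te_coker a), (te_coker_proj a).
exact/te_kernelP/mono_ker_coker.
Qed.

Lemma te_epi_normal (X Y : E) (a : Hom X Y) :
  epi a -> exists (Z : E) (b : Hom Z X), is_cokernel b a.
Proof.
move=> /te_epiP ae; exists (te_ker a), (te_ker_inc a).
exact/te_cokernelP/epi_coker_ker.
Qed.

Definition trivext : abelian :=
  @Abelian E te_zero te_zeroP te_biproduct te_ker te_ker_inc te_ker_incP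
    te_coker te_coker_proj te_coker_projP te_mono_normal te_epi_normal.

(* Under F(X (+) F X) = F X (+) F^2 X, the matrix (0 0; 1 0) is the projection
   [F pr1] to F X followed by [in2]. *)
Definition T_map (X : B) :
  Hom (F (biprod X (F X))) (biprod X (F X)) :=
  in2 (biprod X (F X)) \oc fmap F (pr1 (biprod X (F X))).

Lemma T_mapK (X : B) : T_map X \oc fmap F (T_map X) = 0.
Proof.
rewrite /T_map -compA -fmapC compA pr1_in2 comp0l fmap0.
by rewrite comp0r.
Qed.

Definition T (X : B) : trivext := TeObj (T_mapK X).

Definition T_class (P : B -> Prop) : trivext -> Prop :=
  fun M => exists X : B, P X /\ iso M (T X).

Definition U_preim (P : B -> Prop) : trivext -> Prop := fun M => P (te_car M).

Definition T_adj_map (X : B) (Y : te_obj) (b : Hom X (te_car Y)) :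
  Hom (biprod X (F X)) (te_car Y) :=
  b \oc pr1 (biprod X (F X)) + te_map Y \oc fmap F b \oc pr2 (biprod X (F X)).

Lemma T_adj_subproof (X : B) (Y : te_obj) (b : Hom X (te_car Y)) :
  T_adj_map b \oc T_map X = te_map Y \oc fmap F (T_adj_map b).
Proof.
rewrite /T_adj_map /T_map compDl fmapD compDr !fmapC.
rewrite -(compA b) (compA (pr1 _)) pr1_in2 comp0l comp0r add0r.
rewrite -(compA _ (pr2 _)) (compA (pr2 _)) pr2_in2 comp1m.
by rewrite !compA te_mapK !comp0l addr0.
Qed.

Definition T_adj (X : B) (Y : te_obj) (b : Hom X (te_car Y)) : te_hom (T X) Y :=
  @TeHom (T X) Y (T_adj_map b) (T_adj_subproof b).

Lemma T_hom_ext (X : B) (Y : te_obj) (a a' : te_hom (T X) Y) :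
  val a \oc in1 (biprod X (F X)) = val a' \oc in1 (biprod X (F X)) -> a = a'.
Proof.
have H (c : te_hom (T X) Y) : val c \oc in2 (biprod X (F X)) =
    te_map Y \oc fmap F (val c \oc in1 (biprod X (F X))).
  rewrite fmapC compA -te_homP /= /T_map -!compA -fmapC pr1_in1 fmap1.
  by rewrite compm1.
move=> e; apply: val_inj; set S := biprod X (F X) in e H *.
by rewrite -[LHS]compm1 -[RHS]compm1 -(bip_id S) !compDr !compA !H e.
Qed.

Lemma T_adj_in1 (X : B) (Y : te_obj) (b : Hom X (te_car Y)) :
  val (T_adj b) \oc in1 (biprod X (F X)) = b.
Proof.
by rewrite /= /T_adj_map compDl -!compA pr1_in1 pr2_in1 compm1 !comp0r addr0.
Qed.

Lemma T_projective (P : B) : projective P -> projective (T P).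
Proof.
move=> Pp Y Z e f /te_epiP ee.
have [b be] := Pp _ _ _ (val f \oc in1 (biprod P (F P))) ee.
exists (T_adj b); apply: T_hom_ext.
by rewrite -be -[in RHS](T_adj_in1 b) /= compA.
Qed.

Lemma trivext_enough_projectives :
  enough_projectives B -> enough_projectives trivext.
Proof.
move=> hP X; have [P [e [Pp ee]]] := hP (te_car X).
exists (T P), (T_adj (e : Hom P (te_car X))); split; first exact: T_projective.
apply/te_epiP => Z t t' E; apply: ee.
by rewrite -(T_adj_in1 (e : Hom P (te_car X))) !compA E.
Qed.

End TrivialExtension.

Arguments trivext {B F} hF.
Arguments T {B F} hF X.
Arguments T_class {B F} hF P.
Arguments U_preim {B F} hF P.
Arguments trivext_enough_projectives {B F} hF hP.

(* Main.v *)
From mathcomp Require Import all_boot all_algebra boolp.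
Require Import Defs.

(* Vanishing of Ext^1(A, D) is a lifting property against epimorphisms with
   kernel D. As T is left adjoint to U, lifting T X against an epimorphism of
   the trivial extension is lifting X against its carrier, so Ext^1(X, U D) = 0
   gives Ext^1(T X, D) = 0; conversely, L_1 F X = 0 makes T exact on presentations
   of X, whence Ext^1(T X, D) = 0 gives Ext^1(X, U D) = 0. Completeness comes from
   lifting the approximations 0 -> Y -> X -> U A -> 0 and 0 -> U A -> Y -> X -> 0
   along T: the carriers of the objects of U^-1(Y) so obtained are extensions of
   F X by Y. An object of the left orthogonal class is then a retract of some
   T X, and F^2 = 0 makes it isomorphic to T X' with X' a retract of X. *)

Set Implicit Arguments.
Unset Strict Implicit.
Unset Printing Implicit Defensive.

Import GRing.Theory.
Local Open Scope ring_scope.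

(** * Cancellation and universal properties in preadditive categories *)

Section Preadditive.
Variable C : preadditive.

Lemma mono_eq0 (A B T : C) (f : Hom A B) (t : Hom T A) :
  mono f -> f \oc t = 0 -> t = 0.
Proof. by move=> fm ft; apply: fm; rewrite ft comp0r. Qed.

Lemma epi_eq0 (A B T : C) (f : Hom A B) (t : Hom B T) :
  epi f -> t \oc f = 0 -> t = 0.
Proof. by move=> fe tf; apply: fe; rewrite tf comp0l. Qed.

Lemma kernel_lift (A B K T : C) (f : Hom A B) (k : Hom K A) (t : Hom T A) :
  is_kernel f k -> f \oc t = 0 -> exists u : Hom T K, k \oc u = t.
Proof. by move=> [_ kU] /kU[u [ut _]]; exists u. Qed.

Lemma cokernel_desc (A B Q T : C) (f : Hom A B) (c : Hom B Q) (t : Hom B T) :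
  is_cokernel f c -> t \oc f = 0 -> exists u : Hom Q T, u \oc c = t.
Proof. by move=> [_ cU] /cU[u [ut _]]; exists u. Qed.

Lemma epi_comp (A B T : C) (g : Hom B T) (f : Hom A B) :
  epi g -> epi f -> epi (g \oc f).
Proof. by move=> ge fe D t t'; rewrite !compA => /fe/ge. Qed.

Lemma epi_compr (A B T : C) (g : Hom B T) (f : Hom A B) : epi (g \oc f) -> epi g.
Proof. by move=> gfe D t t' e; apply: gfe; rewrite !compA e. Qed.

Lemma biprod_in_ext (A B T : C) (S : biproduct A B) (t t' : Hom S T) :
  t \oc in1 S = t' \oc in1 S -> t \oc in2 S = t' \oc in2 S -> t = t'.
Proof.
by move=> e1 e2; rewrite -[t]compm1 -[t']compm1 -(bip_id S) !compDr !compA e1 e2.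
Qed.

Lemma biprod_pr_ext (A B T : C) (S : biproduct A B) (t t' : Hom T S) :
  pr1 S \oc t = pr1 S \oc t' -> pr2 S \oc t = pr2 S \oc t' -> t = t'.
Proof.
move=> e1 e2; rewrite -[t]comp1m -[t']comp1m -(bip_id S) !compDl -!compA.
by rewrite e1 e2.
Qed.

Lemma epi_pr2 (A B : C) (S : biproduct A B) : epi (pr2 S).
Proof.
apply: (@epi_compr _ _ _ _ (in2 S)).
by rewrite pr2_in2 => T t t'; rewrite !compm1.
Qed.

End Preadditive.

(** * Kernels, cokernels and short exact sequences *)

Section Abelian.
Variable Ab : abelian.
Implicit Types A B K M N D P T Z : Ab.

Lemma kernel_epi_cokernel A B K (f : Hom A B) (k : Hom K A) :
  is_kernel f k -> epi f -> is_cokernel k f.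
Proof.
move=> kP fe; apply: is_cokernelI => //; first exact: kP.1.
move=> T t tk; apply: cokernel_desc (epi_coker_ker fe) _.
have [u <-] := kernel_lift kP (ker_incP f).1.
by rewrite compA tk comp0l.
Qed.

Lemma mono_cokernel_kernel A B K (f : Hom A B) (k : Hom K A) :
  mono k -> is_cokernel k f -> is_kernel f k.
Proof.
move=> km fP; apply: is_kernelI => //; first exact: fP.1.
move=> T t ft; apply: kernel_lift (mono_ker_coker km) _.
have [u <-] := cokernel_desc fP (coker_projP k).1.
by rewrite -compA ft comp0r.
Qed.

(** For a mono [f], the maps [f] and [im_inc f] factor through each other. Later arguments use this
    kernel-epi form. *)
Lemma short_exactP A B T (f : Hom A B) (g : Hom B T) :
  short_exact f g <-> is_kernel g f /\ epi g.
Proof.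
split=> [[fm ex ge]|[kP ge]].
  split=> //; apply: is_kernelI => //; first exact: exact_comp0.
  move=> D t /(kernel_lift ex)[u <-].
  apply: kernel_lift (mono_ker_coker fm) _.
  by rewrite compA (ker_incP (coker_proj f)).1 comp0l.
have fm := kernel_mono kP; split=> //.
have iP := ker_incP (coker_proj f).
have [v vE] : exists v, f \oc v = im_inc f.
  by apply: kernel_lift (mono_ker_coker fm) _; exact: iP.1.
have [l lE] := kernel_lift iP (coker_projP f).1.
apply: is_kernelI.
- by rewrite -vE compA kP.1 comp0l.
- exact: kernel_mono iP.
- by move=> D t /(kernel_lift kP)[u <-]; exists (l \oc u); rewrite compA lE.
Qed.

Lemma mono_epi_iso A B (f : Hom A B) : mono f -> epi f -> iso A B.
Proof.
move=> fm fe; have c0 := epi_eq0 fe (coker_projP f).1.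
have [|g fg] := kernel_lift (t := idm B) (mono_ker_coker fm).
  by rewrite c0 comp0l.
by exists f, g; split=> //; apply: fm; rewrite compA fg comp1m compm1.
Qed.

(** The pullback is the kernel of [d]. A map killing [b] induces a map on [B], as [d] is the
    cokernel of its kernel, and the latter vanishes after [e]. *)
Lemma epi_pullback A B T (e : Hom A B) (t : Hom T B) : epi e ->
  exists Q (a : Hom Q A) (b : Hom Q T), epi b /\ e \oc a = t \oc b.
Proof.
move=> ee; set S := biprod A T.
pose d : Hom S B := e \oc pr1 S - t \oc pr2 S.
have d1 : d \oc in1 S = e.
  by rewrite compBl -!compA pr1_in1 pr2_in1 compm1 comp0r subr0.
have de : epi d by apply: (epi_compr (f := in1 S)); rewrite d1.
have dk : d \oc ker_inc d = 0 by rewrite (ker_incP d).1.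
exists (ker d), (pr1 S \oc ker_inc d), (pr2 S \oc ker_inc d); split.
  apply: epi_inj0 => D w; rewrite compA => wk.
  have [v vE] := cokernel_desc (epi_coker_ker de) wk.
  have v0 : v = 0.
    by apply: (epi_eq0 ee); rewrite -d1 compA vE -compA pr2_in1 comp0r.
  by apply: (epi_eq0 (@epi_pr2 _ _ _ S)); rewrite -vE v0 comp0l.
by apply/eqP; rewrite -subr_eq0 !compA -compBl dk.
Qed.

(** Since [q] is epi on the first summand already, every second component is reached; where it is
    zero, [k] lands in [X], hence in [D]. *)
Lemma biprod_kernel_extension D X M Z K (S : biproduct X Z) (i : Hom D X)
    (q : Hom S M) (k : Hom K S) :
  is_kernel (q \oc in1 S) i -> epi (q \oc in1 S) -> is_kernel q k ->
  exists a : Hom D K, is_kernel (pr2 S \oc k) a /\ epi (pr2 S \oc k).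
Proof.
move=> iP pe kP; have qe := epi_compr pe; have km := kernel_mono kP.
have [|a aE] := kernel_lift (t := in1 S \oc i) kP; first by rewrite compA iP.1.
exists a; split.
  apply: is_kernelI.
  - by rewrite -compA aE compA pr2_in1 comp0l.
  - apply: mono_inj0 => T t ta; apply: (mono_eq0 (kernel_mono iP)).
    by rewrite -[i]comp1m -(pr1_in1 S) -(compA _ _ i) -aE -!compA ta !comp0r.
  move=> T t; rewrite -compA => t2.
  have kt : k \oc t = in1 S \oc (pr1 S \oc (k \oc t)).
    apply: biprod_pr_ext; rewrite (compA _ (in1 S)) ?pr1_in1 ?comp1m //.
    by rewrite pr2_in1 comp0l.
  have [|d dE] := kernel_lift (t := pr1 S \oc (k \oc t)) iP.
    by rewrite -compA -kt compA kP.1 comp0l.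
  by exists d; apply: km; rewrite compA aE -compA dE -kt.
apply: epi_inj0 => T t; rewrite compA => tk.
have [w wE] := cokernel_desc (kernel_epi_cokernel kP qe) tk.
suff w0 : w = 0 by apply: (epi_eq0 (@epi_pr2 _ _ _ S)); rewrite -wE w0 comp0l.
by apply: (epi_eq0 pe); rewrite compA wE -compA pr2_in1 comp0r.
Qed.

(** * Pushouts of short exact sequences and their splittings *)

Section Pushout.
Variables (K P A D M : Ab) (k : Hom K P) (p : Hom P A) (f : Hom K D).
Let S := biprod D P.
Variable q : Hom S M.
Hypotheses (kP : is_kernel p k) (pe : epi p).
Hypothesis qP : is_cokernel (in1 S \oc f - in2 S \oc k) q.

Lemma pushout_comm : q \oc in1 S \oc f = q \oc in2 S \oc k.
Proof. by apply/eqP; rewrite -subr_eq0 -!compA -compBr qP.1. Qed.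

(** The map from [K] to [S] has mono second component [- k], so it is the kernel of its cokernel
    [q]. *)
Lemma pushout_mono T (t : Hom T S) : q \oc t = 0 -> pr2 S \oc t = 0 -> t = 0.
Proof.
have pk : pr2 S \oc (in1 S \oc f - in2 S \oc k) = - k.
  by rewrite compBr !compA pr2_in1 pr2_in2 comp0l comp1m sub0r.
have km := kernel_mono kP.
have psim : mono (in1 S \oc f - in2 S \oc k).
  apply: mono_inj0 => W w /(congr1 (comp (pr2 S))).
  rewrite compA pk comp0r compNl => /eqP; rewrite oppr_eq0 => /eqP.
  exact: mono_eq0.
move=> qt pt; have [z zE] := kernel_lift (mono_cokernel_kernel psim qP) qt.
move: pt; rewrite -zE compA pk compNl => /eqP; rewrite oppr_eq0 => /eqP.
by move=> /(mono_eq0 km) ->; rewrite comp0r.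
Qed.

(** Leaving [c] arbitrary lets this apply to [pushout_proj] and also to maps built otherwise. *)
Lemma pushout_short_exact (c : Hom M A) : c \oc q = p \oc pr2 S ->
  is_kernel c (q \oc in1 S) /\ epi c.
Proof.
move=> cq; have qe := cokernel_epi qP.
have ce : epi c.
  by apply: (epi_compr (f := q)); rewrite cq; apply: epi_comp pe (@epi_pr2 _ _ _ S).
split=> //; apply: mono_cokernel_kernel.
  apply: mono_inj0 => T t; rewrite -compA => e.
  have := pushout_mono e; rewrite compA pr2_in1 comp0l => /(_ erefl).
  by move=> /(congr1 (comp (pr1 S))); rewrite compA pr1_in1 comp1m comp0r.
apply: is_cokernelI => //.
  by rewrite compA cq -compA pr2_in1 comp0r.
move=> T w w1; have w2 : w \oc q \oc in2 S \oc k = 0.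
  by rewrite -!compA (compA q) -pushout_comm !compA -(compA w) w1 comp0l.
have [u uE] := cokernel_desc (kernel_epi_cokernel kP pe) w2.
exists u; apply: qe; rewrite -compA cq.
apply: (@biprod_in_ext _ _ _ _ S).
  by rewrite -!compA pr2_in1 w1 !comp0r.
by rewrite -!compA pr2_in2 compm1 uE compA.
Qed.

Lemma pushout_proj : exists c : Hom M A, c \oc q = p \oc pr2 S.
Proof.
apply: cokernel_desc qP _.
rewrite compBr -!compA (compA (pr2 S)) (compA (pr2 S)) pr2_in1 pr2_in2.
by rewrite comp0l comp1m kP.1 comp0r subr0.
Qed.

End Pushout.

(** A splitting of the pushout sequence along [f] gives a retraction of [D -> M]; restricted to [P],
    it extends [f]. *)
Lemma split_extend K P A D (k : Hom K P) (p : Hom P A) :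
  (forall M (i : Hom D M) (c : Hom M A), is_kernel c i -> epi c ->
    exists s, c \oc s = idm A) ->
  is_kernel p k -> epi p -> forall f : Hom K D, exists g, g \oc k = f.
Proof.
move=> split kP pe f; set S := biprod D P.
have qP := coker_projP (in1 S \oc f - in2 S \oc k).
set q := coker_proj _ in qP.
have [c cq] := pushout_proj kP qP.
have [iP ce] := pushout_short_exact kP pe qP cq.
have [s cs] := split _ _ _ iP ce.
have [|r rE] := kernel_lift (t := idm _ - s \oc c) iP.
  by rewrite compBr compm1 compA cs comp1m subrr.
exists (r \oc q \oc in2 S); apply: (kernel_mono iP).
rewrite -2!(compA r) (compA _ r) rE compBl comp1m.
rewrite -(compA s) (compA c) (compA c) cq -(compA p) pr2_in2 compm1 kP.1.
by rewrite comp0r subr0 -(pushout_comm qP).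
Qed.

End Abelian.

(** * Vanishing of Ext as an extension and as a lifting property *)

Section Ext.
Variables (Ab : abelian) (hP : enough_projectives Ab).
Implicit Types A B K M N D P T Z : Ab.

(** The differential is the cover of a syzygy followed by its inclusion, so cocycles are exactly the
    maps out of the syzygy, composed with its cover. *)
Lemma Ext_vanish_extendP n A D :
  Ext_vanish hP n.+1 A D <->
  forall f : Hom (syzygy hP A n.+1) D,
    exists g, g \oc ker_inc (proj_epi hP (syzygy hP A n)) = f.
Proof.
rewrite Ext_vanishP; set k := ker_inc (proj_epi hP (syzygy hP A n)).
have ee := @proj_epiP _ hP (syzygy hP A n.+1); split=> H f.
  have [|g gE] := H (f \oc proj_epi hP (syzygy hP A n.+1)).
    rewrite -compA /= (compA (proj_epi _ _)).
    by rewrite (ker_incP (proj_epi hP (syzygy hP A n.+1))).1 comp0l comp0r.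
  by exists g; apply: ee; rewrite gE /= compA.
rewrite /= compA => /(epi_eq0 (@proj_epiP _ hP _)) fk.
have [f' <-] := cokernel_desc (epi_coker_ker ee) fk.
by have [g <-] := H f'; exists g; rewrite /= compA.
Qed.

(** Dimension shifting: both sides unfold to the same extension problem. *)
Lemma Ext_vanish_syzygy n A D :
  Ext_vanish hP n.+2 A D <-> Ext_vanish hP 1 (syzygy hP A n.+1) D.
Proof. by rewrite !Ext_vanish_extendP. Qed.

(** The right-hand side is free of the chosen resolution. A lift over the projective cover is
    corrected by extending its restriction to the kernel; conversely, lifting identities splits the
    pushouts of [split_extend]. *)
Lemma Ext1_liftP A D :
  Ext_vanish hP 1 A D <->
  forall M N (i : Hom D M) (p : Hom M N), is_kernel p i -> epi p ->
    forall a : Hom A N, exists b, p \oc b = a.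
Proof.
rewrite Ext_vanish_extendP /=; set e := proj_epi hP A.
have ee : epi e := @proj_epiP _ hP A; have kP := ker_incP e.
split=> [ext M N i p iP pe a | lift f]; last first.
  by apply: split_extend kP ee f => M i c iP ce; apply: lift iP ce _.
have [b0 b0E] := @proj_coverP _ hP _ _ _ _ (a \oc e) pe.
have [|f fE] := kernel_lift (t := b0 \oc ker_inc e) iP.
  by rewrite compA b0E -compA kP.1 comp0r.
have [g gE] := ext f.
have [|b bE] := cokernel_desc (t := b0 - i \oc g) (epi_coker_ker ee).
  by rewrite compBl -compA gE fE subrr.
exists b; apply: ee.
by rewrite -compA bE compBr compA iP.1 comp0l subr0 b0E.
Qed.

Lemma Ext1_extend A D K Z (k : Hom K Z) (p : Hom Z A) (f : Hom K D) :
  Ext_vanish hP 1 A D -> is_kernel p k -> epi p -> exists g, g \oc k = f.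
Proof.
move=> /Ext1_liftP lift kP pe.
by apply: split_extend kP pe f => M i c iP ce; apply: lift iP ce _.
Qed.

Lemma Ext1_sum A B1 B2 D (u1 : Hom A B1) (v1 : Hom B1 A) (u2 : Hom A B2)
    (v2 : Hom B2 A) :
  v1 \oc u1 + v2 \oc u2 = idm A ->
  Ext_vanish hP 1 B1 D -> Ext_vanish hP 1 B2 D -> Ext_vanish hP 1 A D.
Proof.
move=> uv /Ext1_liftP l1 /Ext1_liftP l2; apply/Ext1_liftP => M N i p iP pe a.
have [b1 b1E] := l1 _ _ _ _ iP pe (a \oc v1).
have [b2 b2E] := l2 _ _ _ _ iP pe (a \oc v2).
exists (b1 \oc u1 + b2 \oc u2).
by rewrite compDr !compA b1E b2E -!compA -compDr uv compm1.
Qed.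

Lemma Ext1_retract A B D (u : Hom A B) (v : Hom B A) :
  v \oc u = idm A -> Ext_vanish hP 1 B D -> Ext_vanish hP 1 A D.
Proof.
move=> vu ext; apply: (Ext1_sum (u1 := u) (v1 := v) (u2 := 0) (v2 := v)) => //.
by rewrite comp0r addr0.
Qed.

Lemma projective_Ext1 P D : projective P -> Ext_vanish hP 1 P D.
Proof. by move=> Pp; apply/Ext1_liftP => M N i p _ pe a; apply: Pp pe. Qed.

(** Extend into [D2], lift to [D] by projectivity, then correct the error, which lies in [D1]. *)
Lemma Ext1_extension A D1 D D2 (i : Hom D1 D) (p : Hom D D2) :
  is_kernel p i -> epi p ->
  Ext_vanish hP 1 A D1 -> Ext_vanish hP 1 A D2 -> Ext_vanish hP 1 A D.
Proof.
move=> iP pe /Ext_vanish_extendP/= e1 /Ext_vanish_extendP/= e2.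
apply/Ext_vanish_extendP => /= f; set k := ker_inc _ in e1 e2 *.
have [g gE] := e2 (p \oc f).
have [h hE] := @proj_coverP _ hP _ _ _ _ g pe.
have [|f' fE] := kernel_lift (t := f - h \oc k) iP.
  by rewrite compBr compA hE gE subrr.
have [h' h'E] := e1 f'; exists (i \oc h' + h).
by rewrite compDl -compA h'E fE subrK.
Qed.

(* Schanuel's lemma in splitting form: comparing the two presentations of [A]
   writes the identity of [K] as a sum of maps through [P] and [K']. *)
Lemma Ext1_schanuel A D K P K' P' (k : Hom K P) (e : Hom P A)
    (k' : Hom K' P') (e' : Hom P' A) :
  projective P -> projective P' ->
  is_kernel e k -> epi e -> is_kernel e' k' -> epi e' ->
  Ext_vanish hP 1 K' D -> Ext_vanish hP 1 K D.
Proof.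
move=> Pp P'p kP ee k'P e'e ext.
have [x xE] := Pp _ _ _ e e'e; have [y yE] := P'p _ _ _ e' ee.
have [|x0 x0E] := kernel_lift (t := x \oc k) k'P.
  by rewrite compA xE kP.1.
have [|y0 y0E] := kernel_lift (t := y \oc k') kP.
  by rewrite compA yE k'P.1.
have [|h hE] := kernel_lift (t := idm _ - y \oc x) kP.
  by rewrite compBr compm1 compA yE xE subrr.
apply: (Ext1_sum (u1 := k) (v1 := h) (u2 := x0) (v2 := y0)) ext.
  apply: (kernel_mono kP); rewrite compDr !compA hE y0E compBl.
  by rewrite -!compA x0E comp1m compm1 subrK.
exact: projective_Ext1.
Qed.

End Ext.

(** * The first left derived functor and preservation of monos *)

Section LeftDerived.
Variables (B : abelian) (hP : enough_projectives B).
Variables (F : additive_functor B B) (hF : right_exact F).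

Lemma fmapN (X Y : B) (f : Hom X Y) : fmap F (- f) = - fmap F f.
Proof. by apply: (addrI (fmap F f)); rewrite -fmapD !subrr fmap0. Qed.

Lemma right_exact_cokernel (X Y Z : B) (f : Hom X Y) (g : Hom Y Z) :
  is_kernel g f -> epi g -> is_cokernel (fmap F f) (fmap F g).
Proof.
move=> fP ge; have [_ ex _] : short_exact f g by apply/short_exactP.
by have [Fex Fe] := hF ex ge; apply: exact_epi_cokernel.
Qed.

(** Zero homology makes [ker_lift] epi, so [fmap F e1] kills the kernel of the differential
    [fmap F (res_d hP X 1)]. The latter is [fmap F k] after the epi [fmap F e1]. *)
Lemma left_derived1_cover_mono (X : B) : is_zero (left_derived hP F 1 X) ->
  mono (fmap F (ker_inc (proj_epi hP X))).
Proof.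
move=> [L0 _]; set k := ker_inc _.
set e1 := proj_epi hP (syzygy hP X 1).
have lam_epi : epi (ker_lift (fmap_res_dd hP F 1 X)).
  apply: epi_inj0 => T t tl.
  have [u <-] := cokernel_desc (coker_projP _) tl.
  by rewrite (L0 _ u) comp0l.
have e1z : fmap F e1 \oc ker_inc (fmap F (res_d hP X 1)) = 0.
  apply: (epi_eq0 lam_epi); rewrite -compA ker_liftE -fmapC /= compA.
  by rewrite (ker_incP e1).1 comp0l fmap0.
have Fe1 : epi (fmap F e1) := right_exact_epi hF (@proj_epiP _ hP _).
apply: mono_inj0 => T t kt.
have [Q [a [b [be abE]]]] := epi_pullback t Fe1.
apply: (epi_eq0 be); rewrite -abE.
have [|a' <-] := kernel_lift (t := a) (ker_incP (fmap F (res_d hP X 1))).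
  by rewrite /= fmapC -compA abE compA kt comp0l.
by rewrite compA e1z comp0l.
Qed.

(* [K -> M (+) P -> Y] is a short exact sequence whose image under [F] stays
   exact on the left, because its second component [F K -> F P] is mono. *)
Lemma left_derived1_mono (M Y X : B) (i : Hom M Y) (p : Hom Y X) :
  is_zero (left_derived hP F 1 X) -> is_kernel p i -> epi p -> mono (fmap F i).
Proof.
move=> /left_derived1_cover_mono; set e := proj_epi hP X; set k := ker_inc e.
move=> Fkm iP pe; have kP : is_kernel e k := ker_incP e.
have ee : epi e := @proj_epiP _ hP X.
have [x xE] := @proj_coverP _ hP _ _ _ _ e pe.
have [|x0 x0E] := kernel_lift (t := x \oc k) iP.
  by rewrite compA xE kP.1.
set S := biprod M (proj_cover hP X).
pose g : Hom S Y := i \oc pr1 S + x \oc pr2 S.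
pose f : Hom (ker e) S := in1 S \oc x0 - in2 S \oc k.
have g1 : g \oc in1 S = i.
  by rewrite compDl -!compA pr1_in1 pr2_in1 compm1 comp0r addr0.
have g2 : g \oc in2 S = x.
  by rewrite compDl -!compA pr1_in2 pr2_in2 compm1 comp0r add0r.
have f2 : pr2 S \oc f = - k.
  by rewrite compBr !compA pr2_in1 pr2_in2 comp0l comp1m sub0r.
have f1 : pr1 S \oc f = x0.
  by rewrite compBr !compA pr1_in1 pr1_in2 comp0l comp1m subr0.
have ge : epi g.
  apply: epi_inj0 => T w wg.
  have wi : w \oc i = 0 by rewrite -g1 compA wg comp0l.
  have wx : w \oc x = 0 by rewrite -g2 compA wg comp0l.
  have [u uE] := cokernel_desc (kernel_epi_cokernel iP pe) wi.
  suff u0 : u = 0 by rewrite -uE u0 comp0l.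
  by apply: (epi_eq0 ee); rewrite -xE compA uE.
have fP : is_kernel g f.
  apply: is_kernelI.
  - by rewrite compBr !compA g1 g2 x0E subrr.
  - apply: mono_inj0 => T t ft; apply: (mono_eq0 (kernel_mono kP)).
    by apply/eqP; rewrite -oppr_eq0 -compNl -f2 -compA ft comp0r.
  move=> T t gt.
  have it : i \oc (pr1 S \oc t) = - (x \oc (pr2 S \oc t)).
    by apply/eqP; rewrite -addr_eq0 !compA -compDl gt.
  have [|c cE] := kernel_lift (t := pr2 S \oc t) kP.
    by rewrite -xE -compA -[x \oc _]opprK -it compNr compA iP.1 comp0l oppr0.
  exists (- c); apply: biprod_pr_ext; rewrite compA ?f1 ?f2.
    by apply: (kernel_mono iP); rewrite it compNr compNr compA x0E -compA cE.
  by rewrite compNr compNl opprK cE.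
have FfE : fmap F (pr2 S) \oc fmap F f = - fmap F k by rewrite -fmapC f2 fmapN.
have Ffm : mono (fmap F f).
  apply: mono_inj0 => T t ft; apply: (mono_eq0 Fkm).
  by apply/eqP; rewrite -oppr_eq0 -compNl -FfE -compA ft comp0r.
have FfP := mono_cokernel_kernel Ffm (right_exact_cokernel fP ge).
(* If [fmap F i] kills [t], then [t] in the first summand comes from some [z], whose image
   [- fmap F k \oc z] in the second summand is zero. *)
apply: mono_inj0 => T t it.
have [|z zE] := kernel_lift (t := fmap F (in1 S) \oc t) FfP.
  by rewrite compA -fmapC g1.
have z0 : z = 0.
  apply: (mono_eq0 Fkm); apply/eqP; rewrite -oppr_eq0 -compNl -FfE -compA zE.
  by rewrite compA -fmapC pr2_in1 fmap0 comp0l.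
by rewrite -[t]comp1m -fmap1 -(pr1_in1 S) fmapC -compA -zE z0 !comp0r.
Qed.

End LeftDerived.

(** * The functor [T] and its effect on Ext *)

Section TrivialExtension.
Variables (B : abelian) (hP : enough_projectives B).
Variables (F : additive_functor B B) (hF : right_exact F).
Local Notation E := (trivext hF).
Local Notation hE := (trivext_enough_projectives hF hP).

Lemma te_kernel_val (X Y K : E) (a : Hom X Y) (k : Hom K X) :
  is_kernel a k -> is_kernel (val a) (val k).
Proof.
move=> kP; have kerP := te_ker_incP a.
have [v /(congr1 val)/= vE] := kernel_lift kP kerP.1.
have km : mono (val k) by apply/te_monoP; apply: kernel_mono kP.
have ak : val a \oc val k = 0 by have /(congr1 val) := kP.1.
apply: is_kernelI => // T t /(kernel_lift (ker_incP (val a)))[u <-].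
by exists (val v \oc u); rewrite compA vE.
Qed.

(** The action of [T] on morphisms, by adjunction; on carriers it is diagonal with entries [b] and
    [fmap F b]. *)
Definition Tmap (X Y : B) (b : Hom X Y) : Hom (T hF X) (T hF Y) :=
  T_adj hF (Y := T hF Y) (in1 (biprod Y (F Y)) \oc b).

Lemma Tmap_in1 (X Y : B) (b : Hom X Y) :
  val (Tmap b) \oc in1 (biprod X (F X)) = in1 (biprod Y (F Y)) \oc b.
Proof. exact: T_adj_in1. Qed.

Lemma TmapE (X Y : B) (b : Hom X Y) : val (Tmap b) =
  in1 (biprod Y (F Y)) \oc b \oc pr1 (biprod X (F X)) +
  in2 (biprod Y (F Y)) \oc fmap F b \oc pr2 (biprod X (F X)).
Proof.
rewrite /= /T_adj_map /= /T_map -(compA _ _ (fmap F _)) -fmapC compA.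
by rewrite pr1_in1 comp1m.
Qed.

Lemma Tmap_in2 (X Y : B) (b : Hom X Y) :
  val (Tmap b) \oc in2 (biprod X (F X)) = in2 (biprod Y (F Y)) \oc fmap F b.
Proof. by rewrite TmapE compDl -!compA pr1_in2 pr2_in2 compm1 !comp0r add0r. Qed.

Lemma Tmap_pr1 (X Y : B) (b : Hom X Y) :
  pr1 (biprod Y (F Y)) \oc val (Tmap b) = b \oc pr1 (biprod X (F X)).
Proof. by rewrite TmapE compDr !compA pr1_in1 pr1_in2 comp1m !comp0l addr0. Qed.

Lemma Tmap_pr2 (X Y : B) (b : Hom X Y) :
  pr2 (biprod Y (F Y)) \oc val (Tmap b) = fmap F b \oc pr2 (biprod X (F X)).
Proof. by rewrite TmapE compDr !compA pr2_in1 pr2_in2 comp1m !comp0l add0r. Qed.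

Lemma Tmap_epi (X Y : B) (b : Hom X Y) : epi b -> epi (Tmap b).
Proof.
move=> be; apply/(te_epiP hF); apply: epi_inj0 => Z w wb.
apply: biprod_in_ext; rewrite comp0l.
  by apply: (epi_eq0 be); rewrite -compA -Tmap_in1 compA wb comp0l.
apply: (epi_eq0 (right_exact_epi hF be)).
by rewrite -compA -Tmap_in2 compA wb comp0l.
Qed.

(** On carriers the sequence is the sum of the given one and its image under [F]; a mono [fmap F k]
    makes the latter exact on the left. *)
Lemma Tmap_kernel (K Y X : B) (k : Hom K Y) (p : Hom Y X) :
  is_kernel p k -> epi p -> mono (fmap F k) -> is_kernel (Tmap p) (Tmap k).
Proof.
move=> kP pe Fkm.
have FkP := mono_cokernel_kernel Fkm (right_exact_cokernel hF kP pe).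
apply: te_kernelP; apply: is_kernelI.
- apply: biprod_pr_ext; rewrite comp0r compA ?Tmap_pr1 ?Tmap_pr2 -compA.
    by rewrite Tmap_pr1 compA kP.1 comp0l.
  by rewrite Tmap_pr2 compA FkP.1 comp0l.
- apply: mono_inj0 => Z t kt; apply: biprod_pr_ext; rewrite comp0r.
    apply: (mono_eq0 (kernel_mono kP)).
    by rewrite compA -Tmap_pr1 -compA kt comp0r.
  by apply: (mono_eq0 Fkm); rewrite compA -Tmap_pr2 -compA kt comp0r.
move=> Z t pt.
have [|u1 u1E] := kernel_lift (t := pr1 (biprod Y (F Y)) \oc t) kP.
  by rewrite compA -Tmap_pr1 -compA pt comp0r.
have [|u2 u2E] := kernel_lift (t := pr2 (biprod Y (F Y)) \oc t) FkP.
  by rewrite compA -Tmap_pr2 -compA pt comp0r.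
exists (in1 (biprod K (F K)) \oc u1 + in2 (biprod K (F K)) \oc u2).
rewrite compDr !compA Tmap_in1 Tmap_in2 -!compA u1E u2E !compA -compDl.
by rewrite bip_id comp1m.
Qed.

Lemma Ext1_T (X : B) (D : E) :
  Ext_vanish hP 1 X (te_car D) -> Ext_vanish hE 1 (T hF X) D.
Proof.
move=> /Ext1_liftP lift; apply/Ext1_liftP => M N i p iP /(te_epiP hF) pe a.
have [s sE] := lift _ _ _ _ (te_kernel_val iP) pe (val a \oc in1 _).
exists (T_adj hF s); apply: T_hom_ext.
by rewrite -sE -[in RHS](T_adj_in1 hF s) compA.
Qed.

(** The transpose of [f] extends along [T] of the syzygy inclusion; its restriction along [in1]
    extends [f]. *)
Lemma Ext1_T_inv (X : B) (D : E) : is_zero (left_derived hP F 1 X) ->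
  Ext_vanish hE 1 (T hF X) D -> Ext_vanish hP 1 X (te_car D).
Proof.
move=> L0 ext; apply/Ext_vanish_extendP => /= f.
have kP := ker_incP (proj_epi hP X); have ee := @proj_epiP _ hP X.
have TkP := Tmap_kernel kP ee (left_derived1_mono hF L0 kP ee).
have [g /(congr1 val)/= gE] :=
  Ext1_extend (T_adj hF f : Hom (T hF _) D) ext TkP (Tmap_epi ee).
exists (val g \oc in1 _); rewrite -[RHS](T_adj_in1 hF f) -compA -Tmap_in1 compA.
by congr (_ \oc _); apply: gE.
Qed.

(** * Retracts of objects [T X] and approximations by them *)

Hypothesis hFF : forall M : B, is_zero (F (F M)).

(* A retract [(M, f)] of [T X] is recovered from [X' = coker f]: as [F^2 = 0],
   [F] turns the projection [M -> X'] into an isomorphism, and the section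
   [X' -> X -> X (+) F X -> M] of that projection is the restriction to [X'] of
   an isomorphism [T X' -> M]. *)
Lemma T_retract (X : B) (A : E) (j : Hom A (T hF X)) (r : Hom (T hF X) A) :
  r \oc j = idm A ->
  exists (X' : B) (u : Hom X' X) (v : Hom X X'), v \oc u = idm X' /\
    iso A (T hF X').
Proof.
move=> /(congr1 val)/= rj; set S := biprod X (F X).
set f := te_map A; have cP := coker_projP f; set c := coker_proj f in cP.
have ce := cokernel_epi cP.
have jf : val j \oc f = in2 S \oc fmap F (pr1 S \oc val j).
  by rewrite fmapC compA; apply: (te_homP j).
have rf : val r \oc T_map F X = f \oc fmap F (val r) by apply: (te_homP r).
have [u uE] : exists u, u \oc c = pr1 S \oc val j.
  by apply: cokernel_desc cP _; rewrite -compA jf compA pr1_in2 comp0l.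
(* The summand [F X] is the image of the structure map of [T X], so [r] sends it into the image of
   [f], which [c] kills. *)
have cr2 : c \oc val r \oc in2 S = 0.
  have -> : in2 S = T_map F X \oc fmap F (in1 S).
    by rewrite /T_map -compA -fmapC pr1_in1 fmap1 compm1.
  rewrite -(compA c) (compA (val r)) rf !compA cP.1.
  by rewrite !comp0l.
pose v := c \oc val r \oc in1 S.
have vpr : v \oc pr1 S = c \oc val r.
  apply: (@biprod_in_ext _ _ _ _ S).
    by rewrite -compA pr1_in1 compm1.
  by rewrite -compA pr1_in2 comp0r cr2.
have vu : v \oc u = idm _.
  apply: ce; rewrite -compA uE compA vpr -compA.
  by rewrite [X in c \oc X]rj compm1 comp1m.
exists (coker f), u, v; split=> //.
have [s cs] : exists s, c \oc s = idm _.
  by exists (val r \oc in1 S \oc u); rewrite !compA.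
(* The source of [fmap F f] is a zero object, so the identity descends along its cokernel
   [fmap F c]. *)
have [w wE] : exists w, w \oc fmap F c = idm _.
  by apply: cokernel_desc (right_exact_coker hF f) _; apply: (hFF _).1.
have Fsc : fmap F s \oc fmap F c = idm _.
  suff <- : w = fmap F s by [].
  by rewrite -[LHS]compm1 -fmap1 -cs fmapC compA wE comp1m.
have [f' f'E] : exists f', f' = f \oc fmap F s by eexists.
have f'c : f' \oc fmap F c = f by rewrite f'E -compA Fsc compm1.
have Fce : epi (fmap F c) := right_exact_epi hF ce.
have f'm : mono f'.
  have : (fmap F v \oc pr2 S \oc val j) \oc f' = idm _.
    apply: Fce; rewrite -compA f'c -compA jf (compA _ (in2 S)) -(compA _ (pr2 S)).
    rewrite pr2_in2 compm1 comp1m -fmapC compA vpr.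
    by rewrite -compA [X in c \oc X]rj compm1.
  by move=> l T t t' e; rewrite -[t]comp1m -[t']comp1m -l -!(compA _ f') e.
pose g : Hom (T hF (coker f)) A := T_adj hF (s : Hom _ (te_car A)).
have gE : val g = s \oc pr1 _ + f' \oc pr2 _ by rewrite f'E.
have cf' : c \oc f' = 0 by apply: (epi_eq0 Fce); rewrite -compA f'c cP.1.
have gm : mono g.
  apply/te_monoP; apply: mono_inj0 => T t gt; move: (gt).
  move=> /(congr1 (comp c)); rewrite gE comp0r compA compDr !compA cs cf'.
  rewrite comp1m comp0l addr0 => p1t; apply: biprod_pr_ext; rewrite comp0r //.
  apply: (mono_eq0 f'm); move: gt; rewrite gE compDl -(compA s) p1t comp0r add0r.
  by rewrite compA.
have ge : epi g.
  apply/(te_epiP hF); apply: epi_inj0 => T t tg.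
  have ts : t \oc s = 0.
    have : t \oc val g \oc in1 _ = 0 by rewrite tg comp0l.
    by rewrite gE -compA compDl -!compA pr1_in1 pr2_in1 !comp0r addr0 compm1.
  have tf : t \oc f' = 0.
    have : t \oc val g \oc in2 _ = 0 by rewrite tg comp0l.
    by rewrite gE -compA compDl -!compA pr1_in2 pr2_in2 !comp0r add0r compm1.
  have [|t' t'E] := cokernel_desc (t := t) cP; first by rewrite -f'c compA tf comp0l.
  by move: ts; rewrite -t'E -compA cs compm1 => ->; rewrite comp0l.
have [a [b [ab ba]]] := mono_epi_iso gm ge.
by exists b, a.
Qed.

(* The kernel of [T X -> (M, f)] is an extension of [F X] by the kernel of
   [X -> M]. *)
Lemma T_cover (A : E) (X D : B) (i : Hom D X) (p : Hom X (te_car A)) :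
  is_kernel p i -> epi p ->
  exists (D' : E) (k : Hom D' (T hF X)) (q : Hom (T hF X) A)
    (a : Hom D (te_car D')) (b : Hom (te_car D') (F X)),
    [/\ is_kernel q k, epi q, is_kernel b a & epi b].
Proof.
move=> iP pe; set S := biprod X (F X); pose q : Hom (T hF X) A := T_adj hF p.
have q1 : val q \oc in1 S = p by exact: T_adj_in1.
have qe : epi q.
  by apply/(te_epiP hF); apply: (epi_compr (f := in1 S)); rewrite q1.
have iP' : is_kernel (val q \oc in1 S) i by rewrite q1.
have pe' : epi (val q \oc in1 S) by rewrite q1.
have [a [aP be]] := biprod_kernel_extension iP' pe' (ker_incP (val q)).
exists (te_ker q), (te_ker_inc q), q, a, (pr2 S \oc ker_inc (val q)).
by split=> //; apply: te_ker_incP.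
Qed.

(* The extension of [T X] by [(M, f)] is the pushout of [T M -> T Y -> T X]
   along the counit [T M -> (M, f)]. Since the kernel of the counit is [F M] with
   zero structure map, that pushout is a cokernel of [F M -> T Y], whose carrier
   is the pushout of [F M -> F Y -> F X] along [F M -> M -> Y]. *)
Lemma T_hull (A : E) (Y X : B) (i : Hom (te_car A) Y) (p : Hom Y X) :
  is_kernel p i -> epi p -> mono (fmap F i) ->
  exists (D : E) (m : Hom A D) (c : Hom D (T hF X))
    (a : Hom Y (te_car D)) (b : Hom (te_car D) (F X)),
    [/\ is_kernel c m, epi c, is_kernel b a & epi b].
Proof.
move=> iP pe Fim; set S := biprod Y (F Y).
have im := kernel_mono iP; set f := te_map A.
have FiP := mono_cokernel_kernel Fim (right_exact_cokernel hF iP pe).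
have Fpe : epi (fmap F p) := right_exact_epi hF pe.
pose Z : E := @TeObj B F (F (te_car A)) 0 (comp0l _ _).
pose phi := in1 S \oc (i \oc f) - in2 S \oc fmap F i.
have phiE : phi \oc te_map Z = te_map (T hF Y) \oc fmap F phi.
  by rewrite comp0r; symmetry; apply: (hFF _).1.
pose phiT : Hom Z (T hF Y) := @TeHom _ _ Z (T hF Y) phi phiE.
pose D : E := te_coker hF phiT.
have qTP : is_cokernel phiT (te_coker_proj hF phiT) := te_coker_projP hF phiT.
have qP : is_cokernel phi (val (te_coker_proj hF phiT)) by exact: coker_projP.
set qT := te_coker_proj hF phiT in qTP qP; set q := val qT in qP.
have comm := pushout_comm qP; have qmono := pushout_mono FiP qP.
have qm : q \oc T_map F Y = te_map D \oc fmap F q by apply: (te_homP qT).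
(* The relation [comm] trades [i \oc f] in the first summand for [fmap F i] in the second, where the
   structure map of [T Y] lands. *)
have mE : (q \oc in1 S \oc i) \oc te_map A =
    te_map D \oc fmap F (q \oc in1 S \oc i).
  rewrite -(compA _ i) comm -(compA q (in1 S)) fmapC (compA (te_map D)) -qm.
  rewrite -!(compA q); congr (q \oc _).
  by rewrite /T_map -compA -fmapC compA pr1_in1 comp1m.
pose m : Hom A D := @TeHom _ _ A D _ mE.
have pphi : Tmap p \oc phiT = 0.
  apply: val_inj => /=; rewrite -[T_adj_map _]/(val (Tmap p)) /phi.
  rewrite compBr !compA Tmap_in1 Tmap_in2 -(compA _ p i) iP.1.
  by rewrite -(compA _ (fmap F p)) -fmapC iP.1 fmap0 !comp0r !comp0l subrr.
have [c cqT] := cokernel_desc qTP pphi.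
have cq : val c \oc q = val (Tmap p) by rewrite -cqT.
have bq : pr2 (biprod X (F X)) \oc val c \oc q = fmap F p \oc pr2 S.
  by rewrite -compA cq Tmap_pr2.
have [iP' be] := pushout_short_exact FiP Fpe qP bq.
exists D, m, c, (q \oc in1 S), (pr2 (biprod X (F X)) \oc val c).
have ce : epi c by apply: (epi_compr (f := qT)); rewrite cqT; apply: Tmap_epi.
(* Besides [m] being mono, [c] must be its cokernel: a map killing [m] descends along [p] on the
   first summand and along [fmap F p] on the second. *)
split=> //; apply: te_kernelP; apply: mono_cokernel_kernel.
  apply: mono_inj0 => T t /= mt.
  by apply: (mono_eq0 im); apply: (mono_eq0 (kernel_mono iP')); rewrite compA.
have qe := cokernel_epi qP.
apply: is_cokernelI.
- by rewrite /= !compA cq Tmap_in1 -compA iP.1 comp0r.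
- exact/(te_epiP hF).
move=> T w /= wm.
have [|w1 w1E] := cokernel_desc (t := w \oc q \oc in1 S) (kernel_epi_cokernel iP pe).
  by rewrite -wm !compA.
have [|w2 w2E] := cokernel_desc (t := w \oc q \oc in2 S)
    (right_exact_cokernel hF iP pe).
  rewrite -!compA (compA q) -comm !compA.
  by move: wm; rewrite !compA => ->; rewrite comp0l.
exists (w1 \oc pr1 (biprod X (F X)) + w2 \oc pr2 (biprod X (F X))).
apply: qe; rewrite -compA cq compDl -!(compA _ _ (val (Tmap p))).
rewrite Tmap_pr1 Tmap_pr2 !compA w1E w2E -!(compA (w \oc q)) -compDr bip_id.
by rewrite compm1.
Qed.

End TrivialExtension.

(** * Assembly of orthogonality, completeness and heredity *)

Theorem corollary3p15 (B : abelian)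
  (hP : enough_projectives B) (hI : enough_injectives B)
  (F : additive_functor B B) (hF : right_exact F)
  (hFF : forall M : B, is_zero (F (F M)))
  (X Y : B -> Prop)
  (hXY : hereditary_complete_cotorsion_pair hP X Y)
  (hL : forall M : B, X M -> is_zero (left_derived hP F 1 M))
  (hFX : forall M : B, X M -> Y (F M)) :
  hereditary_complete_cotorsion_pair (Ab := trivext hF)
    (trivext_enough_projectives hF hP) (T_class hF X) (U_preim hF Y).
Proof.
set hE := trivext_enough_projectives hF hP.
have [[XP YP] complete hered] := hXY.
have Yext (D1 D D2 : B) (i : Hom D1 D) (p : Hom D D2) :
    is_kernel p i -> epi p -> Y D1 -> Y D2 -> Y D.
  move=> iP pe Y1 Y2; apply/YP => A XA.
  by apply: Ext1_extension iP pe _ _; apply: hered.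
have TX_ext A D : T_class hF X A -> U_preim hF Y D -> Ext_vanish hE 1 A D.
  move=> [M [XM [u [v [vu _]]]]] YD; apply: (Ext1_retract vu).
  by apply: Ext1_T; apply: hered.
have TX_complete A : exists D C (k : Hom D C) (q : Hom C A),
    [/\ U_preim hF Y D, T_class hF X C, is_kernel q k & epi q].
  have [D0 [M [i [p [YD XM /short_exactP[iP pe]]]]]] := (complete (te_car A)).1.
  have [D [k [q [a [b [kP qe aP be]]]]]] := T_cover iP pe.
  exists D, (T hF M), k, q; split=> //; first exact: Yext aP be YD (hFX _ XM).
  exists M; split=> //; exists (idm _), (idm _).
  by rewrite comp1m.
have TXP A : T_class hF X A <-> forall D, U_preim hF Y D -> Ext_vanish hE 1 A D.
  split=> [TA D|ext]; first exact: TX_ext.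
  (* The cover splits, since its kernel lies in [U_preim hF Y]; hence [A] is a retract of [T M]. *)
  have [D [C [k [q [YD [M [XM [u [v [vu _]]]]] kP qe]]]]] := TX_complete A.
  have /Ext1_liftP lift := ext D YD.
  have [s qs] := lift _ _ _ _ kP qe (idm A).
  have [|M' [u' [v' [v'u' isoA]]]] := T_retract hFF (j := u \oc s) (r := q \oc v).
    by rewrite -compA (compA v) vu comp1m.
  exists M'; split=> //; apply/XP => D' YD'.
  by apply: (Ext1_retract v'u'); apply: hered.
have TT M : X M -> T_class hF X (T hF M).
  by move=> XM; exists M; split=> //; exists (idm _), (idm _); rewrite comp1m.
have TX_syzygy A : T_class hF X A -> T_class hF X (syzygy hE A 1).
  move=> [M [XM [u [v [vu uv]]]]]; apply/TXP => D YD /=.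
  have kP := ker_incP (proj_epi hP M); have ee := @proj_epiP _ hP M.
  (* Heredity in [B] gives vanishing Ext in degree two, shifted here to the syzygy. *)
  have XK : X (ker (proj_epi hP M)).
    by apply/XP => D' YD'; apply/(Ext_vanish_syzygy hP 0); apply: hered.
  have TkP := Tmap_kernel hF kP ee (left_derived1_mono hF (hL _ XM) kP ee).
  have vm : mono v by move=> Z t t' e; rewrite -[t]comp1m -[t']comp1m -uv -!compA e.
  have ve : epi v by move=> Z t t' e; rewrite -[t]compm1 -[t']compm1 -vu !compA e.
  (* The chosen presentation of [A] is compared with [T] of the presentation of [M], carried to [A]
     by the isomorphism [v]. *)
  apply: (Ext1_schanuel (k := ker_inc (proj_epi hE A)) (e := proj_epi hE A)
    (k' := Tmap hF (ker_inc (proj_epi hP M)))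
    (e' := v \oc Tmap hF (proj_epi hP M))).
  - exact: proj_coverP.
  - exact/T_projective/proj_coverP.
  - exact: ker_incP.
  - exact: proj_epiP.
  - split=> [|Z t]; first by rewrite -compA TkP.1 comp0r.
    by rewrite -compA => /(mono_eq0 vm); apply: TkP.2.
  - exact/epi_comp/Tmap_epi.
  by apply: TX_ext => //; apply: TT.
split; first split=> // D.
- split=> [YD A TA|ext]; first exact: TX_ext.
  by apply/YP => M XM; apply: Ext1_T_inv (hL _ XM) (ext _ (TT _ XM)).
- move=> A; split.
    have [D [C [k [q [YD TC kP qe]]]]] := TX_complete A.
    by exists D, C, k, q; split=> //; apply/short_exactP.
  have [N [M [i [p [YN XM /short_exactP[iP pe]]]]]] := (complete (te_car A)).2.
  have Fim := left_derived1_mono hF (hL _ XM) iP pe.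
  have [D [m [c [a [b [mP ce aP be]]]]]] := T_hull (hF := hF) hFF iP pe Fim.
  exists D, (T hF M), m, c; split; [exact: Yext aP be YN (hFX _ XM)|exact: TT|].
  exact/short_exactP.
have TX_syzygies n A : T_class hF X A -> T_class hF X (syzygy hE A n).
  by move=> TA; elim: n => //= n /TX_syzygy.
(* Degrees above one reduce to degree one on a syzygy, which stays in the class. *)
case=> [|[|n]] // A D _ TA YD; first exact: TX_ext.
by apply/Ext_vanish_syzygy/TX_ext => //; apply: TX_syzygies.
Qed.
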